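(* Let $k\geq 2$ and $n$ be positive integers, and let $\mathcal{F}\subset 2^{[n]}$ be a $k$-cross-free family. Then $|\mathcal{F}|=O_{k}(n\log^{*}n)$, i.e. there is a constant $c_k>0$ depending only on $k$ such that $|\mathcal{F}|\leq c_k\, n\log^{*}n$ for all such $n$ and $\mathcal{F}$.
   Context: $[n]=\{1,\dots,n\}$ and $2^{[n]}$ is the family of all subsets of $[n]$. Two sets $A,B\subset[n]$ are crossing if $A\setminus B$, $B\setminus A$, $A\cap B$ and $[n]\setminus(A\cup B)$ are all non-empty. A family $\mathcal{F}\subset 2^{[n]}$ is $k$-cross-free if it does not contain $k$ pairwise crossing sets. $\log$ is base 2, $\log_{(i)}n$ denotes the $i$-fold iterated logarithm, and $\log^{*}n$ is the largest positive integer $i$ such that $\log_{(i)}n>1$. *)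

(* Defs.v *)
From mathcomp Require Import all_boot.
From Stdlib Require Import Reals.
Set Implicit Arguments. Unset Strict Implicit. Unset Printing Implicit Defensive.

Definition crossing (n : nat) (A B : {set 'I_n}) : bool :=
  [&& A :\: B != set0, B :\: A != set0, A :&: B != set0
    & ~: (A :|: B) != set0].

Definition k_cross_free (n k : nat) (F : {set {set 'I_n}}) : Prop :=
  ~ exists G : {set {set 'I_n}},
      [/\ G \subset F, #|G| = k &
          {in G &, forall A B, A != B -> crossing A B}].

Local Open Scope R_scope.

Definition log2 (x : R) : R := ln x / ln 2.
Fixpoint iterlog (i : nat) (x : R) : R :=
  match i with O => x | S j => log2 (iterlog j x) end.

(* log* n = largest positive i with log_(i) n > 1.  Since log2 x <= x - 1
   for x >= 1, any such i satisfies i < n, so searching i in 1..n is exact.  Convention: if no such i exists (n <= 2) we set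
   log* n = 1. *)
Definition logstar (n : nat) : nat :=
  foldr (fun i acc => if Rlt_dec 1 (iterlog i (INR n)) then Nat.max i acc else acc)
        1%nat (iota 1 n).

(* Main.v *)
(* Complementing the sets through a fixed point, we may assume that crossing
   means "intersecting and incomparable"; let w = k - 1. Consider the sets of
   size in [2^j, 2^(j+1)). Those below a fixed maximal one M pairwise meet, so
   they have width at most w and contain a chain of length at least a fraction
   1/w of their number; and each point lies in at most w maximal sets. Give each
   member A_t of such a chain a mark, a point of A_t \ A_(t-1), and let a_g(y) be
   the last set of the block of g consecutive members of the chain in which the
   mark y occurs. For a set A, the marks y in A with A contained in a_g(y) number
   at most w g.

   Now take levels lo, ..., lo+L-1 with L^(2w) <= 2^lo and the scales
   g_0 > ... > g_w, where g_(w-i) = L^(2i). For levels i < j and a < b, the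
   set a_(g_a)(y) of level i takes only O(n / g_a) values, so it can be contained
   in the set a_(g_b)(y) of level j for only O(n g_b / g_a) = O(n / L^2) marks y.
   Dropping those marks costs O(n) over all
   levels; a point that remains a mark in w + 1 levels gives w + 1 pairwise
   crossing sets. Hence these L levels contain O(n) sets. As L may be exponential
   in lo, about log* n such ranges of levels suffice. *)

Require Import Defs.
From Stdlib Require Import Reals Lra.
From mathcomp Require Import all_boot zify.
Set Implicit Arguments. Unset Strict Implicit. Unset Printing Implicit Defensive.

(* zify loads ring_scope, which takes over the key %R. *)
Delimit Scope R_scope with R.

(** * Weak crossing, long chains and their marks *)

Lemma card_bigcup_leq (I T : finType) (P : pred I) (A : I -> {set T}) :
  #|\bigcup_(i | P i) A i| <= \sum_(i | P i) #|A i|.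
Proof.
elim/big_rec2: _ => [|i m X _ le_X]; first by rewrite cards0.
by apply: leq_trans (leq_card_setU _ _) _; rewrite leq_add2l.
Qed.

(** Peel off the minimal members, which form an antichain, and induct: the chain found among the
    rest starts at a non-minimal set, so it extends downwards by one set. *)
Lemma mirsky (T : finType) (w : nat) (G : {set {set T}}) :
  (forall H : {set {set T}}, H \subset G ->
     {in H &, forall A B : {set T}, A != B -> ~~ (A \subset B)} -> #|H| <= w) ->
  exists s : seq {set T},
    [/\ sorted (fun A B : {set T} => A \proper B) s, {subset s <= G}
      & #|G| <= w * size s].
Proof.
have [m] := ubnP #|G|; elim: m G => // m IHm G ltGm widthG.
have [->|] := eqVneq G set0; first by exists [::]; split=> //; rewrite cards0.
case/set0Pn=> A0 GA0; pose Min := [set A in G | [forall B in G, ~~ (B \proper A)]].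
have sMinG : Min \subset G by apply/subsetP=> A; rewrite inE => /andP[].
have leMin : #|Min| <= w.
  apply: widthG => // A B; rewrite !inE => /andP[GA _] /andP[_ /forall_inP minB] neqAB.
  by apply: contra (minB A GA) => sAB; rewrite properEneq neqAB.
have [A MinA] : exists A, A \in Min.
  case: (arg_minnP (fun A : {set T} => #|A|) GA0) => A GA minA.
  exists A; rewrite inE (GA : A \in G); apply/forall_inP=> B GB.
  by apply/negP=> /proper_card; rewrite ltnNge minA.
have cardG : #|G| = #|Min| + #|G :\: Min|.
  by rewrite -(cardsID Min G) (setIidPr sMinG).
have [| |s [sort_s sub_s le_s]] := IHm (G :\: Min).
- have : 0 < #|Min| by rewrite card_gt0; apply/set0Pn; exists A.
  by move: ltGm; rewrite cardG; lia.
- by move=> H sHG; apply: widthG; apply: subset_trans sHG (subsetDl _ _).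
case: s sort_s sub_s le_s => [|X s] sort_s sub_s le_s.
  exists [:: A]; split=> //=; last by rewrite cardG; move: le_s; rewrite muln0; lia.
  by move=> B; rewrite inE => /eqP->; apply: (subsetP sMinG).
have := sub_s X (mem_head _ _); rewrite !inE => /andP[nMinX GX].
move: nMinX; rewrite GX /= negb_forall_in => /exists_inP[B GB /negPn ltBX].
exists [:: B, X & s]; split=> //=.
- by rewrite ltBX.
- move=> C; rewrite inE => /predU1P[->//|/sub_s]; by rewrite inE => /andP[].
- by rewrite cardG mulnS leq_add.
Qed.

(** This is crossing for sets that all miss a common point. As [A] and [B] range over ordered pairs,
    one non-inclusion expresses incomparability. *)
Definition weakly_cross_free (T : finType) (w : nat) (F : {set {set T}}) :=
  forall G : {set {set T}}, G \subset F ->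
    {in G &, forall A B : {set T}, A != B -> (A :&: B != set0) && ~~ (A \subset B)} ->
  #|G| <= w.

Lemma weakly_cross_freeS (T : finType) (w : nat) (F F' : {set {set T}}) :
  F' \subset F -> weakly_cross_free w F -> weakly_cross_free w F'.
Proof. by move=> sF'F wF G sGF'; apply: wF; apply: subset_trans sF'F. Qed.

Lemma chain_marks (T : finType) (s : seq {set T}) (x0 : T) :
  sorted (fun A B : {set T} => A \proper B) s -> set0 \notin s ->
  exists m : seq T, [/\ size m = size s, uniq m,
    forall t, t < size s -> nth x0 m t \in nth set0 s t &
    forall t u, t < u < size s -> nth x0 m u \notin nth set0 s t].
Proof.
move=> sort_s ne0.
have ltS t u : t < u < size s -> nth set0 s t \proper nth set0 s u.
  case/andP=> ltu lus; apply: (sorted_ltn_nth _ set0 sort_s) => //.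
  - by move=> A B C; apply: proper_trans.
  - by rewrite inE; apply: ltn_trans lus.
(* Successive differences, non-empty because the chain is strict and avoids [set0]; the first set is
   compared with [set0]. *)
pose D t := nth set0 s t :\: (if t is u.+1 then nth set0 s u else set0).
pose f t := odflt x0 [pick y in D t].
have fD t : t < size s -> f t \in D t.
  move=> lts; rewrite /f; case: pickP => //= D0.
  have : D t = set0 by apply/setP=> y; rewrite D0 inE.
  rewrite {f D0}/D; case: t lts => [|t] lts.
    by rewrite setD0 => s0; case/negP: ne0; rewrite -s0 mem_nth.
  move/eqP; rewrite setD_eq0 => /subset_leq_card.
  by rewrite leqNgt => /negP[]; apply: proper_card; apply: ltS; rewrite ltnSn.
have fP t u : t < u < size s -> f u \notin nth set0 s t.
  case: u => // u /andP[letu lts]; have := fD _ lts; rewrite inE => /andP[nfu _].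
  apply: contra nfu; move: letu; rewrite ltnS leq_eqVlt => /predU1P[->//|ltu].
  have /proper_sub/subsetP : nth set0 s t \proper nth set0 s u.
    by apply: ltS; rewrite ltu /=; lia.
  exact.
exists (mkseq f (size s)); split.
- by rewrite size_mkseq.
- apply/(uniqP x0)=> t u; rewrite !inE size_mkseq => ltt ltu; rewrite !nth_mkseq //.
  have fs v : v < size s -> f v \in nth set0 s v by move/fD; rewrite inE => /andP[].
  have [ltu'|ltu'|//] := ltngtP t u => e.
    by have := fP t u; rewrite ltu' ltu -e fs // => /(_ isT).
  by have := fP u t; rewrite ltu' ltt e fs // => /(_ isT).
- by move=> t lts; rewrite nth_mkseq //; have := fD _ lts; rewrite inE => /andP[].
- by move=> t u /andP[ltu lts]; rewrite nth_mkseq //; apply: fP; rewrite ltu.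
Qed.

(** * Marks within a single dyadic level *)

Lemma segment_end_lt (g t u : nat) :
  0 < g -> t %/ g < u %/ g -> t %/ g * g + g.-1 < u.
Proof.
move=> g_gt0 lt_tu; have := leq_mul lt_tu (leqnn g); have := leq_divM u g.
rewrite mulSn; lia.
Qed.

(** Each maximal set carries a chain of its subsets; [Y] collects the marks of these chains, and
    [a g y] rounds [y] up to the end of its block of length [g]. A large [g] leaves few values, a
    small [g] leaves few marks above a fixed [A]. *)
Lemma level_marks (T : finType) (w s : nat) (F : {set {set T}}) :
  0 < s -> {in F, forall B : {set T}, s <= #|B| < s.*2} -> weakly_cross_free w F ->
  exists (Y : {set T}) (a : nat -> T -> {set T}),
  [/\ #|F| <= w * w * #|Y|,
      forall g y, y \in Y -> 0 < g -> a g y \in F /\ y \in a g y,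
      forall g, 0 < g -> s * g * #|a g @: Y| <= (s + g) * w * #|T| &
      forall g (A : {set T}), 0 < g ->
        #|[set y in Y | (y \in A) && (A \subset a g y)]| <= w * g].
Proof.
move=> s_gt0 sizeF wF.
have [->|/set0Pn[B0 FB0]] := eqVneq F set0.
  exists set0, (fun _ _ => set0); split=> [|g y|g _|g A _].
  - by rewrite cards0.
  - by rewrite inE.
  - by rewrite imset0 cards0 muln0.
  - by rewrite (_ : [set y in _ | _] = set0) ?cards0 //; apply/setP=> y; rewrite !inE.
have [x0 _] : exists x, x \in B0.
  by apply/set0Pn; rewrite -card_gt0; case/andP: (sizeF _ FB0); lia.
pose Max := [set A in F | [forall B in F, ~~ (A \proper B)]].
have MaxF M : M \in Max -> M \in F by rewrite inE => /andP[].
(* Distinct maximal sets through a common point intersect and are incomparable. *)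
have star_le y (H : {set {set T}}) :
    H \subset Max -> {in H, forall A : {set T}, y \in A} -> #|H| <= w.
  move=> sHM Hy; apply: wF => [|A B HA HB neqAB].
    by apply: subset_trans sHM _; apply/subsetP=> M /MaxF.
  apply/andP; split; first by apply/set0Pn; exists y; rewrite inE !Hy.
  have := subsetP sHM _ HA; rewrite inE => /andP[_ /forall_inP/(_ B)].
  rewrite (MaxF _ (subsetP sHM _ HB)) properEneq neqAB => /(_ isT).
  by [].
have MaxP B : B \in F -> exists2 M, M \in Max & B \subset M.
  move=> FB; have FBB : (B \in F) && (B \subset B) by rewrite FB subxx.
  case: (@arg_maxnP _ B (fun C : {set T} => (C \in F) && (B \subset C))
           (fun C : {set T} => #|C|) FBB) => M /andP[FM sBM] maxM.
  exists M => //; rewrite inE FM; apply/forall_inP=> C FC.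
  apply/negP=> ltMC; have := maxM C; rewrite FC (subset_trans sBM (proper_sub ltMC)).
  by move/(_ isT); apply/negP; rewrite -ltnNge; apply: proper_card.
have /fin_all_exists[cm cmP] (M : {set T}) : exists cm : seq {set T} * seq T,
    M \in Max ->
    [/\ [/\ size cm.2 = size cm.1, uniq cm.2,
        {subset cm.1 <= [set B in F | B \subset M]} &
        #|[set B in F | B \subset M]| <= w * size cm.1],
      forall t u, t <= u < size cm.1 -> nth set0 cm.1 t \subset nth set0 cm.1 u,
      forall t, t < size cm.1 -> nth x0 cm.2 t \in nth set0 cm.1 t &
      forall t u, t < u < size cm.1 -> nth x0 cm.2 u \notin nth set0 cm.1 t].
  have [MaxM|_] := boolP (M \in Max); last by exists ([::], [::]).
  have [|c [sort_c sub_c le_c]] := @mirsky T w [set B in F | B \subset M].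
    move=> H sHF antiH; apply: wF => [|A B HA HB neqAB].
      by apply: subset_trans sHF _; apply/subsetP=> B; rewrite inE => /andP[].
    have := subsetP sHF _ HA; have := subsetP sHF _ HB; rewrite !inE.
    case/andP=> FB sBM /andP[FA sAM]; rewrite antiH // andbT -card_gt0.
    (* Two subsets of [M] meet, since their sizes add up to at least [2 * s], more than the size of
       [M]. *)
    have leUM : #|A :|: B| <= #|M| by rewrite subset_leq_card // subUset sAM.
    case/andP: (sizeF _ FA) (sizeF _ FB) (sizeF _ (MaxF _ MaxM)) => leA _ /andP[leB _] /andP[_ ltM].
    rewrite -(ltn_add2l #|A :|: B|) addn0 cardsUI.
    apply: leq_ltn_trans leUM (leq_trans ltM _).
    by rewrite -addnn leq_add.
  have [|m [size_m uniq_m inm notinm]] := chain_marks x0 sort_c.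
    apply/negP=> /sub_c; rewrite inE => /andP[/sizeF]; rewrite cards0; lia.
  exists (c, m) => _; split=> //= t u /andP[letu ltuc].
  move: letu; rewrite leq_eqVlt => /predU1P[->//|ltu]; apply: proper_sub.
  apply: (sorted_ltn_nth _ set0 sort_c) => //.
  - by move=> A B C; apply: proper_trans.
  - by rewrite inE; apply: ltn_trans ltuc.
pose c M := (cm M).1; pose m M := (cm M).2.
pose Y := \bigcup_(M in Max) [set y in m M].
(* A point may be a mark in several chains; one is fixed here. The default occurs only outside
   [Y]. *)
pose mu y := odflt set0 [pick M in Max | y \in m M].
(* [ix g M t] is the last index in the block of length [g] containing [t],
   cut off at the end of the chain. *)
pose ix g M t := minn (size (c M)).-1 (t %/ g * g + g.-1).
pose a g y := nth set0 (c (mu y)) (ix g (mu y) (index y (m (mu y)))).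
have muP y : y \in Y -> mu y \in Max /\ y \in m (mu y).
  case/bigcupP=> M MaxM; rewrite inE => ym; rewrite /mu.
  by case: pickP => [M' /andP[]//|/(_ M)]; rewrite MaxM ym.
have ixP g M t : 0 < g -> t < size (c M) -> t <= ix g M t < size (c M).
  move=> g_gt0 ltt; rewrite /ix; move: (divn_eq t g) (ltn_pmod t g_gt0); lia.
(* Double counting: a mark of [M] lies in [M], so [y] is a mark for at most [w] maximal sets. *)
have sMY : \sum_(M in Max) size (m M) <= w * #|Y|.
  have -> : \sum_(M in Max) size (m M) = \sum_(M in Max) \sum_(y in Y | y \in m M) 1.
    apply: eq_bigr => M MaxM; case: (cmP M MaxM) => -[_ uniq_m _ _ _ _ _].
    rewrite sum1_card -(card_uniqP uniq_m); apply: eq_card => y; rewrite [RHS]inE.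
    rewrite andbC; case: (boolP (y \in m M)) => //= ym.
    by symmetry; apply/bigcupP; exists M => //; rewrite inE.
  rewrite (exchange_big_dep (mem Y)) /=; last by move=> M y _ /andP[].
  rewrite mulnC -sum_nat_const; apply: leq_sum => y Yy.
  rewrite sum1_card (eq_card (B := [set M in Max | y \in m M])); last first.
    by move=> M; rewrite [RHS]inE; transitivity [&& M \in Max, y \in Y & y \in m M]; rewrite // Yy.
  apply: (star_le y) => [|M]; first by apply/subsetP=> M; rewrite inE => /andP[].
  rewrite inE => /andP[MaxM ym]; case: (cmP M MaxM) => -[szm _ subc _] _ mc _.
  have ltt : index y (m M) < size (c M) by rewrite -szm index_mem.
  have := subc _ (mem_nth set0 ltt); rewrite inE => /andP[_ /subsetP]; apply.
  by rewrite -{1}(nth_index x0 ym); apply: mc.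
have idxP y : y \in Y -> index y (m (mu y)) < size (c (mu y)).
  case/muP=> MaxM ym; case: (cmP _ MaxM) => -[szm _ _ _] _ _ _.
  by rewrite -szm index_mem.
have aP g y : y \in Y -> 0 < g -> [/\ a g y \in F, y \in a g y & a g y \subset mu y].
  move=> Yy g_gt0; have [MaxM ym] := muP y Yy; have ltt := idxP y Yy.
  case: (cmP _ MaxM) => -[szm _ subc _] monoc mc _.
  have /andP[_ lt2] := ixP g _ _ g_gt0 ltt.
  have := subc _ (mem_nth set0 lt2); rewrite inE => /andP[Fa saM]; split=> //.
  apply: (subsetP (monoc _ _ (ixP g _ _ g_gt0 ltt))).
  by rewrite -{1}(nth_index x0 ym); apply: mc.
(* Double counting: a maximal set has at least [s] points, and each point is in at most [w] of
   them. *)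
have cardMax : s * #|Max| <= w * #|T|.
  apply: (@leq_trans (\sum_(M in Max) \sum_(y in M) 1)).
    rewrite mulnC -sum_nat_const; apply: leq_sum => M MaxM.
    by rewrite sum1_card; case/andP: (sizeF _ (MaxF _ MaxM)).
  rewrite (exchange_big_dep predT) //= mulnC -sum_nat_const; apply: leq_sum => y _.
  rewrite sum1_card (eq_card (B := [set M in Max | y \in M])); last first.
    by move=> M; rewrite [RHS]inE.
  apply: (star_le y) => [|M]; first by apply/subsetP=> M; rewrite inE => /andP[].
  by rewrite inE => /andP[].
exists Y, a; split=> [|g y Yy g_gt0|g g_gt0|g A g_gt0].
- have sFU : F \subset \bigcup_(M in Max) [set B in F | B \subset M].
    apply/subsetP=> B FB; have [M MaxM sBM] := MaxP B FB.
    by apply/bigcupP; exists M; rewrite // inE FB.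
  apply: leq_trans (subset_leq_card sFU) _; apply: leq_trans (card_bigcup_leq _ _) _.
  rewrite -mulnA; apply: leq_trans (_ : w * \sum_(M in Max) size (m M) <= _); last first.
    by rewrite leq_mul2l sMY orbT.
  rewrite big_distrr; apply: leq_sum => M MaxM.
  by case: (cmP _ MaxM) => -[szm _ _ leM] _ _ _; rewrite /m szm.
- by case: (aP g y Yy g_gt0).
- pose f M q := nth set0 (c M) (minn (size (c M)).-1 (q * g + g.-1)).
  have imU : a g @: Y \subset
      \bigcup_(M in Max) [set f M q | q : 'I_(size (c M) %/ g).+1].
    apply/subsetP=> _ /imsetP[y Yy ->]; have [MaxM _] := muP y Yy.
    apply/bigcupP; exists (mu y) => //.
    have ltq : index y (m (mu y)) %/ g < (size (c (mu y)) %/ g).+1.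
      by rewrite ltnS leq_div2r // ltnW // idxP.
    by apply/imsetP; exists (Ordinal ltq).
  (* One value per block; the possibly incomplete last block of each chain accounts for the summand
     [g]. *)
  have le1 : g * #|a g @: Y| <= \sum_(M in Max) (size (m M) + g).
    apply: leq_trans (_ : g * \sum_(M in Max) (size (c M) %/ g).+1 <= _).
      rewrite leq_mul2l; apply/orP; right.
      apply: leq_trans (subset_leq_card imU) _; apply: leq_trans (card_bigcup_leq _ _) _.
      apply: leq_sum => M _; apply: leq_trans (leq_imset_card _ _) _.
      by rewrite card_ord.
    rewrite big_distrr; apply: leq_sum => M MaxM.
    case: (cmP _ MaxM) => -[szm _ _ _] _ _ _.
    rewrite /= mulnS addnC leq_add2r mulnC /m szm; exact: leq_divM.
  move: le1; rewrite big_split sum_nat_const => le1.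
  have leY : #|Y| <= #|T| by apply: max_card.
  have le2 : w * #|Y| <= w * #|T| by rewrite leq_mul2l leY orbT.
  have le3 : g * #|a g @: Y| <= w * #|T| + #|Max| * g.
    by apply: leq_trans le1 _; rewrite leq_add2r (leq_trans sMY).
  rewrite -mulnA !mulnDl; apply: leq_trans (leq_mul (leqnn s) le3) _.
  by rewrite mulnDr leq_add ?mulnA // -mulnA (mulnC _ g) mulnCA -mulnA leq_mul.
(* Since [A \subset a g y \subset mu y], each counted mark belongs to some [M] above [A], and all
   these [M] contain [z0]. *)
pose H := [set M in Max | A \subset M].
set Z := [set y in Y | _].
have [->|/set0Pn[z0 Zz0]] := eqVneq Z set0; first by rewrite cards0.
have leH : #|H| <= w.
  apply: (star_le z0) => [|M]; first by apply/subsetP=> M; rewrite inE => /andP[].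
  rewrite inE => /andP[_ /subsetP]; apply.
  by move: Zz0; rewrite inE => /and3P[].
have sZ : Z \subset \bigcup_(M in H) [set y in Z | mu y == M].
  apply/subsetP=> y Zy; apply/bigcupP; exists (mu y); last by rewrite inE Zy /=.
  move: Zy; rewrite !inE => /and3P[Yy _ sAa].
  have [MaxM _] := muP y Yy; move: MaxM; rewrite inE => -> /=.
  by case: (aP g y Yy g_gt0) => _ _; apply: subset_trans.
apply: leq_trans (subset_leq_card sZ) _; apply: leq_trans (card_bigcup_leq _ _) _.
apply: leq_trans (_ : \sum_(M in H) g <= _); last by rewrite sum_nat_const leq_mul2r leH orbT.
apply: leq_sum => M; rewrite inE => /andP[MaxM sAM].
(* If [y] came in a later block than [z], it would be missing from [a g z], which contains [A] and
   hence [y]. So the marks counted for one [M] share a block. *)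
have same y z : y \in Z -> z \in Z -> mu y = M -> mu z = M ->
    index y (m M) %/ g <= index z (m M) %/ g.
  rewrite !inE => /and3P[Yy Ay sAy] /and3P[Yz Az sAz] yM zM.
  rewrite leqNgt; apply/negP=> lt_q.
  have := idxP y Yy; have := muP y Yy; rewrite yM => -[_ ym] lty.
  case: (cmP _ MaxM) => -[szm _ _ _] _ _ notin.
  have := notin (ix g M (index z (m M))) (index y (m M)).
  rewrite -/(m M) (nth_index x0 ym) -/(c M).
  have /subsetP/(_ y Ay) := sAz; rewrite /a zM => ->.
  rewrite lty andbT => notin'; suff: false by []; apply: notin'.
  rewrite /ix gtn_min; apply/orP; right.
  exact: segment_end_lt.
have [->|/set0Pn[y0]] := eqVneq [set y in Z | mu y == M] set0; first by rewrite cards0.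
rewrite inE => /andP[Zy0 /eqP My0].
(* Within a block the index modulo [g] determines the mark; [inord] needs the successor form
   [g.-1.+1]. *)
pose h (y : T) := inord (index y (m M) %% g) : 'I_g.-1.+1.
rewrite -(prednK g_gt0) -[leqRHS]card_ord -(card_in_imset (f := h)) ?max_card //.
move=> y z /setIdP[Zy /eqP My] /setIdP[Zz /eqP Mz] /(congr1 val) /=.
rewrite !inordK ?prednK ?ltn_pmod // => eqmod.
have eqq : index y (m M) %/ g = index z (m M) %/ g by apply/eqP; rewrite eqn_leq !same.
have eqi : index y (m M) = index z (m M).
  by rewrite (divn_eq (index y _) g) (divn_eq (index z _) g) eqq eqmod.
have ym : y \in m M by rewrite -My; case: (muP y _) => //; move: Zy; rewrite inE => /andP[].
have zm : z \in m M by rewrite -Mz; case: (muP z _) => //; move: Zz; rewrite inE => /andP[].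
by rewrite -(nth_index x0 ym) eqi nth_index.
Qed.

(** * Ranges of consecutive dyadic levels *)

Definition level (T : finType) (F : {set {set T}}) (j : nat) :=
  [set B in F | 2 ^ j <= #|B| < 2 ^ j.+1].

Lemma sorted_enum_set (n : nat) (A : {set 'I_n}) :
  sorted (fun i j : 'I_n => i < j) (enum A).
Proof.
rewrite {1}/enum_mem sorted_filter //; first by move=> i j l; apply: ltn_trans.
by have := iota_ltn_sorted 0 n; rewrite -val_enum_ord sorted_map enumT.
Qed.

(** The gain is that the bound is independent of [L], whereas adding up single levels would cost a
    factor [L]. *)
Lemma level_block (T : finType) (w lo L : nat) (F : {set {set T}}) :
  weakly_cross_free w F -> 0 < L -> L ^ (2 * w) <= 2 ^ lo ->
  \sum_(i < L) #|level F (lo + i)|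
    <= w * w * (w + w.+1 * w.+1 * (2 * w * w)) * #|T|.
Proof.
move=> wF L_gt0 leL.
have levelF i : level F i \subset F by apply/subsetP=> B; rewrite inE => /andP[].
have /fin_all_exists[Ya YaP] (i : 'I_L) :
    exists Ya : {set T} * (nat -> T -> {set T}),
    [/\ #|level F (lo + i)| <= w * w * #|Ya.1|,
      forall g y, y \in Ya.1 -> 0 < g -> Ya.2 g y \in level F (lo + i) /\ y \in Ya.2 g y,
      forall g, 0 < g ->
        2 ^ (lo + i) * g * #|Ya.2 g @: Ya.1| <= (2 ^ (lo + i) + g) * w * #|T| &
      forall g (A : {set T}), 0 < g ->
        #|[set y in Ya.1 | (y \in A) && (A \subset Ya.2 g y)]| <= w * g].
  have [|||Y [a YaP]] := @level_marks T w (2 ^ (lo + i)) (level F (lo + i)).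
  - by rewrite expn_gt0.
  - by move=> B; rewrite inE -mul2n -expnS => /andP[].
  - exact: weakly_cross_freeS wF.
  by exists (Y, a).
pose Y (i : 'I_L) := (Ya i).1; pose al (i : 'I_L) := (Ya i).2.
(* The scales fall by a factor [L ^ 2] from [L ^ (2 * w)] at [a = 0] to 1 at [a = w]; the hypothesis
   on [lo] keeps them at most [2 ^ lo]. *)
pose g a := (L ^ 2) ^ (w - a).
have L2_gt0 : 0 < L ^ 2 by rewrite expn_gt0 L_gt0.
have g_gt0 a : 0 < g a by rewrite expn_gt0 L2_gt0.
have g_lt a b : a < b -> b <= w -> L ^ 2 * g b <= g a.
  by move=> ltab lebw; rewrite /g -expnS leq_pexp2l //; lia.
have g_le a i : g a <= 2 ^ (lo + i).
  apply: (@leq_trans (2 ^ lo)); last by rewrite leq_pexp2l // leq_addr.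
  by apply: leq_trans leL; rewrite expnM leq_pexp2l // leq_subr.
(* Badness: the coarse set of [y] at level [i] lies inside its finer set at the higher level
   [p.1]. *)
pose bad (i : 'I_L) y (p : 'I_L * ('I_w.+1 * 'I_w.+1)) :=
  [&& i < p.1, p.2.1 < p.2.2, y \in Y p.1 & al i (g p.2.1) y \subset al p.1 (g p.2.2) y].
pose Z (i : 'I_L) := [set y in Y i | [exists p, bad i y p]].
have leZ i : L ^ 2 * #|Z i| <= L * (w.+1 * w.+1 * (2 * w * w * #|T|)).
  (* Sort bad marks by their set [A] at level [i]: few values at scale [p.2.1], and few marks above
     each at scale [p.2.2]. *)
  have sZ : Z i \subset \bigcup_(p : 'I_L * ('I_w.+1 * 'I_w.+1) | p.2.1 < p.2.2)
      \bigcup_(A in al i (g p.2.1) @: Y i)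
        [set y in Y p.1 | (y \in A) && (A \subset al p.1 (g p.2.2) y)].
    apply/subsetP=> y /setIdP[Yy /existsP[p /and4P[_ ltp Yp sub]]].
    apply/bigcupP; exists p => //; apply/bigcupP.
    exists (al i (g p.2.1) y); first exact: imset_f.
    rewrite inE Yp sub andbT /=.
    by case: (YaP i) => _ /(_ (g p.2.1) y Yy (g_gt0 _))[].
  apply: (@leq_trans (\sum_(p : 'I_L * ('I_w.+1 * 'I_w.+1) | p.2.1 < p.2.2)
                        2 * w * w * #|T|)); last first.
    apply: (@leq_trans (\sum_(p : 'I_L * ('I_w.+1 * 'I_w.+1)) 2 * w * w * #|T|)).
      by rewrite [leqRHS](bigID (fun p : 'I_L * ('I_w.+1 * 'I_w.+1) => p.2.1 < p.2.2)) leq_addr.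
    by rewrite sum_nat_const !card_prod !card_ord !mulnA.
  apply: leq_trans (leq_mul (leqnn _) (subset_leq_card sZ)) _.
  apply: leq_trans (leq_mul (leqnn _) (card_bigcup_leq _ _)) _.
  rewrite big_distrr; apply: leq_sum => -[j [a b]] /= ltab.
  apply: leq_trans (leq_mul (leqnn _) (card_bigcup_leq _ _)) _.
  apply: leq_trans (_ : L ^ 2 * \sum_(A in al i (g a) @: Y i) w * g b <= _).
    rewrite leq_mul2l; apply/orP; right; apply: leq_sum => A _.
    by case: (YaP j) => _ _ _; apply.
  have imle : g a * #|al i (g a) @: Y i| <= 2 * w * #|T|.
    case: (YaP i) => _ _ /(_ _ (g_gt0 a)) im _.
    rewrite -(@leq_pmul2l (2 ^ (lo + i))) ?expn_gt0 // mulnA.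
    apply: leq_trans im _; rewrite !mulnA !leq_mul //.
    by rewrite muln2 -addnn leq_add2l.
  rewrite sum_nat_const.
  rewrite (mulnCA _ w) mulnCA (mulnCA _ #|_ @: _|) (mulnC (2 * w)) -(mulnA w) leq_mul2l.
  apply/orP; right; apply: leq_trans imle; rewrite mulnC leq_mul2r g_lt ?orbT //.
  by rewrite -ltnS.
have leYZ : \sum_(i < L) #|Y i :\: Z i| <= w * #|T|.
  have -> : \sum_(i < L) #|Y i :\: Z i| = \sum_(i < L) \sum_(y in Y i :\: Z i) 1.
    by apply: eq_bigr => i _; rewrite sum1_card.
  rewrite (exchange_big_dep predT) //= mulnC -sum_nat_const; apply: leq_sum => y _.
  rewrite sum1_card (eq_card (B := [set i | y \in Y i :\: Z i])); last first.
    by move=> i; rewrite [RHS]inE.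
  set I := [set i | _]; rewrite leqNgt; apply/negP=> ltwI.
  have ltI (a : 'I_w.+1) : a < size (enum I).
    by rewrite -cardE; apply: leq_ltn_trans _ ltwI; rewrite -ltnS.
  pose f (a : 'I_w.+1) := nth (Ordinal L_gt0) (enum I) a.
  have fI a : f a \in I by rewrite -mem_enum mem_nth.
  have f_lt (a b : 'I_w.+1) : a < b -> f a < f b.
    move=> ltab; apply: (sorted_ltn_nth _ (Ordinal L_gt0) (sorted_enum_set I)) => //.
    - by move=> i j l; apply: ltn_trans.
    - exact: ltI.
    - exact: ltI.
  (* Higher levels get finer scales: inclusion upwards would make [y] bad, and inclusion downwards
     is excluded by size. *)
  pose S (c : 'I_w.+1) := al (f c) (g c) y.
  have fY c : y \in Y (f c) by have := fI c; rewrite !inE => /andP[].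
  have SP c : S c \in level F (lo + f c) /\ y \in S c.
    by case: (YaP (f c)) => _ aY _ _; apply: aY (fY c) (g_gt0 c).
  have nsub (a b : 'I_w.+1) : a < b -> ~~ (S a \subset S b).
    move=> ltab; have := fI a; rewrite !inE fY andbT /= => /existsPn/(_ (f b, (a, b))).
    by rewrite /bad /= f_lt // ltab fY.
  have nsub' (a b : 'I_w.+1) : a < b -> ~~ (S b \subset S a).
    move=> ltab; apply/negP=> /subset_leq_card; rewrite leqNgt => /negP; apply.
    have [/setIdP[_ /andP[_ ltSa]] _] := SP a; have [/setIdP[_ /andP[leSb _]] _] := SP b.
    apply: leq_trans ltSa (leq_trans _ leSb); rewrite leq_pexp2l //.
    by have := f_lt a b ltab; lia.
  have nsubS a b : a != b -> ~~ (S a \subset S b).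
    by rewrite -val_eqE neq_ltn => /orP[/nsub|/nsub'].
  have S_inj : injective S.
    by move=> a b eqS; apply/eqP/negPn/negP=> /nsubS; rewrite eqS subxx.
  suff : #|S @: setT| <= w by rewrite card_imset // cardsT card_ord ltnn.
  apply: wF => [|A B].
    by apply/subsetP=> _ /imsetP[a _ ->]; case: (SP a) => /(subsetP (levelF _)).
  move=> /imsetP[a _ ->] /imsetP[b _ ->] neqS; rewrite nsubS; last first.
    by apply: contra neqS => /eqP->.
  rewrite andbT; apply/set0Pn; exists y; rewrite inE.
  by case: (SP a) (SP b) => _ -> [_ ->].
(* One factor [L] comes from the choice of the higher level, the other from the sum over [i];
   together they cancel [L ^ 2]. *)
have leSZ : \sum_(i < L) #|Z i| <= w.+1 * w.+1 * (2 * w * w * #|T|).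
  rewrite -(leq_pmul2l L2_gt0) big_distrr /=.
  apply: leq_trans (_ : \sum_(i < L) L * (w.+1 * w.+1 * (2 * w * w * #|T|)) <= _).
    by apply: leq_sum => i _; apply: leZ.
  by rewrite sum_nat_const card_ord mulnA mulnn.
apply: (@leq_trans (\sum_(i < L) w * w * #|Y i|)).
  by apply: leq_sum => i _; case: (YaP i).
rewrite -big_distrr -!(mulnA (w * w)) leq_mul2l; apply/orP; right.
apply: (@leq_trans (\sum_(i < L) (#|Y i :\: Z i| + #|Z i|))).
  apply: leq_sum => i _; rewrite addnC -(cardsID (Z i) (Y i)) leq_add2r.
  by rewrite subset_leq_card // subsetIr.
by rewrite big_split mulnDl leq_add // -mulnA.
Qed.

(** Marks are points of [T], so [#|Y| <= #|T|]. This crude bound serves the boundedly many lowest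
    levels. *)
Lemma level_leq (T : finType) (w j : nat) (F : {set {set T}}) :
  weakly_cross_free w F -> #|level F j| <= w * w * #|T|.
Proof.
move=> wF; have [|||Y [a [leY _ _ _]]] := @level_marks T w (2 ^ j) (level F j).
- by rewrite expn_gt0.
- by move=> B; rewrite inE -mul2n -expnS => /andP[].
- by apply: weakly_cross_freeS wF; apply/subsetP=> B; rewrite inE => /andP[].
by apply: leq_trans leY _; rewrite leq_mul2l max_card orbT.
Qed.

(** * Thresholds growing like a tower of exponentials *)

Definition tower (m : nat) := iter m (expn 2) 1.

Lemma ltn_tower m : m < tower m.
Proof. by elim: m => //= m IHm; apply: leq_ltn_trans IHm (ltn_expl _ _). Qed.

(* The thresholds lo_N = K (tower N + 3 K) with K = 2 w satisfy both
   lo_(N+1) - lo_N <= L and L ^ K = 2 ^ lo_N for L = 2 ^ (tower N + 3 K). *)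
Lemma sum_levels_tower (T : finType) (w N : nat) (F : {set {set T}}) :
  weakly_cross_free w F ->
  \sum_(j < 2 * w * (tower N + 3 * (2 * w))) #|level F j|
    <= (2 * w * (1 + 3 * (2 * w)) * (w * w)
        + N * (w * w * (w + w.+1 * w.+1 * (2 * w * w)))) * #|T|.
Proof.
move=> wF; set K := 2 * w; elim: N => [|N IHN].
  rewrite mul0n addn0 -mulnA -[X in X * (w * w * _)]card_ord -sum_nat_const.
  by apply: leq_sum => j _; apply: level_leq.
set lo := K * (tower N + 3 * K) in IHN *; set hi := K * _.
pose L := 2 ^ (tower N + 3 * K).
have K3 : K * (1 + 3 * K) <= 2 ^ (3 * K).
  have ltK : K < 2 ^ K by apply: ltn_expl.
  apply: leq_trans (_ : K.+1 ^ 3 <= _); first by rewrite !expnS expn0; nia.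
  by rewrite (mulnC 3) expnM leq_exp2r.
(* [L] equals [tower N.+1 * 2 ^ (3 * K)]: the summand [3 * K] in the threshold provides the factor
   that absorbs [K * (1 + 3 * K)]. *)
have hiL : hi <= lo + L.
  apply: leq_trans (leq_addl _ _); rewrite /hi /L expnD -/(tower N.+1).
  have : 0 < tower N.+1 by apply: leq_ltn_trans (ltn_tower _).
  move=> t_gt0; apply: leq_trans (leq_mul (leqnn (tower N.+1)) K3).
  rewrite mulnCA leq_mul2l mulnDr muln1 leq_add2l leq_pmull //; exact: orbT.
apply: (@leq_trans (\sum_(j < lo + L) #|level F j|)).
  rewrite -!(big_mkord predT (fun j => #|level F j|)).
  by rewrite [leqRHS](big_cat_nat (n := hi)) //= leq_addr.
rewrite big_split_ord /= (mulSn N) addnCA mulnDl addnC leq_add //.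
by apply: level_block; rewrite // ?expn_gt0 // /L -expnM mulnC.
Qed.

(** The leading 1 is for the empty set, which lies in no level; all other sizes are below
    [2 ^ tower N], so the levels below [tower N] suffice. *)
Lemma weakly_cross_free_bound (T : finType) (w N : nat) (F : {set {set T}}) :
  0 < w -> weakly_cross_free w F -> #|T| < tower N.+1 ->
  #|F| <= 1 + (2 * w * (1 + 3 * (2 * w)) * (w * w)
        + N * (w * w * (w + w.+1 * w.+1 * (2 * w * w)))) * #|T|.
Proof.
move=> w_gt0 wF ltT; set hi := 2 * w * (tower N + 3 * (2 * w)).
have sF : F \subset set0 |: \bigcup_(j < hi) level F j.
  apply/subsetP=> B FB; rewrite in_setU1; have [//|B0 /=] := eqVneq B set0.
  have cB : 0 < #|B| by rewrite card_gt0.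
  have lt_hi : trunc_log 2 #|B| < hi.
    apply: (@leq_trans (tower N)); last by rewrite /hi; nia.
    rewrite -(@ltn_exp2l 2) //; apply: leq_ltn_trans ltT.
    by apply: leq_trans (max_card (mem B)); apply: trunc_logP.
  apply/bigcupP; exists (Ordinal lt_hi) => //.
  by rewrite inE FB trunc_logP //= trunc_log_ltn.
apply: leq_trans (subset_leq_card sF) _; apply: leq_trans (leq_card_setU _ _) _.
rewrite cards1 leq_add2l; apply: leq_trans (card_bigcup_leq _ _) _.
exact: sum_levels_tower.
Qed.

(** * From crossing to weak crossing by complementation *)

(** Crossing survives complementing both sets, so members containing [x0] are replaced by their
    complements; for sets avoiding [x0] the fourth region contains [x0]. The two halves give the
    factor 2. *)
Lemma card_cross_free (n w N : nat) (F : {set {set 'I_n}}) :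
  0 < n -> 0 < w -> k_cross_free w.+1 F -> n < tower N.+1 ->
  #|F| <= 2 * (1 + (2 * w * (1 + 3 * (2 * w)) * (w * w)
        + N * (w * w * (w + w.+1 * w.+1 * (2 * w * w)))) * n).
Proof.
move=> n_gt0 w_gt0 cfF ltn; pose x0 := Ordinal n_gt0.
have crossF (G : {set {set 'I_n}}) : G \subset F ->
    {in G &, forall A B : {set 'I_n}, A != B -> crossing A B} -> #|G| <= w.
  move=> sGF crG; rewrite leqNgt; apply/negP=> ltwG; apply: cfF.
  (* [k_cross_free] speaks of exactly [w.+1] sets, so a larger family is cut down. *)
  have [H sHG cH] : exists2 H : {set {set 'I_n}}, H \subset G & #|H| = w.+1.
    exists [set A in take w.+1 (enum G)].
      by apply/subsetP=> A; rewrite inE => /mem_take; rewrite mem_enum.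
    rewrite cardsE (card_uniqP _) ?take_uniq ?enum_uniq // size_takel //.
    by rewrite -cardE.
  exists H; split=> //; first exact: subset_trans sHG sGF.
  by move=> A B HA HB; apply: crG; apply: (subsetP sHG).
pose F0 := [set A in F | x0 \notin A]; pose F1 := [set A in F | x0 \in A].
have crossE (A B : {set 'I_n}) : x0 \notin A -> x0 \notin B ->
    A :&: B != set0 -> ~~ (A \subset B) -> ~~ (B \subset A) -> crossing A B.
  move=> A0 B0 AB sAB sBA; rewrite /crossing !setD_eq0 sAB sBA AB /=.
  by apply/set0Pn; exists x0; rewrite !inE negb_or A0.
have crossC (A B : {set 'I_n}) : crossing (~: A) (~: B) = crossing A B.
  have setDC (X Y : {set 'I_n}) : ~: X :\: ~: Y = Y :\: X by rewrite !setDE setCK setIC.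
  rewrite /crossing !setDC -setCU -setCI setCK andbCA.
  by congr [&& _, _ & _]; apply: andbC.
have wF0 : weakly_cross_free w F0.
  move=> G sG wG; apply: crossF => [|A B GA GB neqAB].
    by apply: subset_trans sG _; apply/subsetP=> A; rewrite inE => /andP[].
  have := subsetP sG _ GA; have := subsetP sG _ GB; rewrite !inE.
  move=> /andP[_ B0] /andP[_ A0]; have /andP[AB sAB] := wG A B GA GB neqAB.
  have /andP[_ sBA] : (B :&: A != set0) && ~~ (B \subset A) by rewrite wG // eq_sym.
  exact: crossE.
have wF1 : weakly_cross_free w [set ~: A | A in F1].
  move=> G sG wG; rewrite -(card_imset _ (@setC_inj _)).
  have inF1 A : A \in G -> ~: A \in F1.
    by move/(subsetP sG)=> /imsetP[B FB ->]; rewrite setCK.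
  apply: crossF => [|_ _ /imsetP[A GA ->] /imsetP[B GB ->]].
    by apply/subsetP=> _ /imsetP[A /inF1 + ->]; rewrite inE => /andP[].
  rewrite (inj_eq (@setC_inj _)) crossC => neqAB.
  have := inF1 _ GA; have := inF1 _ GB; rewrite !inE.
  move=> /andP[_ B0] /andP[_ A0]; have /andP[AB sAB] := wG A B GA GB neqAB.
  have /andP[_ sBA] : (B :&: A != set0) && ~~ (B \subset A) by rewrite wG // eq_sym.
  exact: crossE.
have -> : #|F| = #|F0| + #|[set ~: A | A in F1]|.
  rewrite (card_imset _ (@setC_inj _)) -(cardsID F1 F) addnC; congr (_ + _).
    by apply: eq_card => A; rewrite !inE andbC; case: (A \in F) => //; rewrite andbT.
  by apply: eq_card => A; rewrite !inE; case: (A \in F).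
rewrite mul2n -addnn leq_add // -[X in _ * X](card_ord n).
  by apply: weakly_cross_free_bound; rewrite ?card_ord.
by apply: weakly_cross_free_bound; rewrite ?card_ord.
Qed.

(** * Towers and the iterated logarithm *)

Lemma INR_exp2 (m : nat) : INR (2 ^ m) = (2 ^ m)%R.
Proof. by elim: m => //= m IHm; rewrite expnS mult_INR IHm. Qed.

Lemma log2_ge (m : nat) (x : R) : (INR (2 ^ m) <= x)%R -> (INR m <= log2 x)%R.
Proof.
rewrite INR_exp2 => le_x; have ln2 := ln_lt_2; have pos2 : (0 < 2 ^ m)%R by apply: pow_lt; lra.
have ln2_gt0 : (0 < ln 2)%R by lra.
apply: (Rmult_le_reg_r (ln 2)) => //.
rewrite /log2 /Rdiv Rmult_assoc Rinv_l ?Rmult_1_r; last by lra.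
rewrite -ln_pow; last by lra.
by case: le_x => [/(ln_increasing _ _ pos2)|<-]; lra.
Qed.

(** Each base-2 logarithm removes one storey of the tower. *)
Lemma iterlog_tower (i j : nat) (x : R) :
  (INR (tower (i + j)) <= x)%R -> (INR (tower j) <= iterlog i x)%R.
Proof.
elim: i j => //= i IHi j le_x; apply: log2_ge; apply: (IHi j.+1).
by rewrite addnS.
Qed.

Lemma leq_logstar (n m : nat) :
  0 < m <= n -> (1 < iterlog m (INR n))%R -> m <= logstar n.
Proof.
move=> m_n gt1; rewrite /logstar.
have : m \in iota 1 n by rewrite mem_iota add1n ltnS.
elim: (iota 1 n) => //= i s IHs; rewrite inE => /predU1P[<-|/IHs le_m].
  by case: Rlt_dec => [?|//] /=; lia.
by case: Rlt_dec => ? /=; lia.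
Qed.

Lemma logstar_gt0 (n : nat) : 0 < logstar n.
Proof. by rewrite /logstar; elim: (iota 1 n) => //= i s; case: Rlt_dec => ? /=; lia. Qed.

(** Otherwise [logstar n + 1] logarithms would leave at least [tower 1 = 2 > 1], against maximality;
    [ltn_tower] puts this index in the searched range. *)
Lemma ltn_tower_logstar (n : nat) : n < tower (logstar n).+2.
Proof.
rewrite ltnNge; apply/negP=> le_n; set m := (logstar n).+1 in le_n.
suff : m <= logstar n by rewrite ltnn.
apply: leq_logstar.
  apply/andP; split=> //; apply: leq_trans le_n.
  by apply: ltnW; apply: ltnW; apply: ltn_tower.
have : (INR (tower 1) <= iterlog m (INR n))%R.
  by apply: iterlog_tower; rewrite addn1; apply: le_INR; apply/leP.
by rewrite /=; lra.
Qed.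

(** * Choice of the constant *)

Theorem theorem1 :
  forall k : nat, (2 <= k)%nat ->
  exists c : R, (0 < c)%R /\
    forall (n : nat) (F : {set {set 'I_n}}),
      (0 < n)%nat -> k_cross_free k F ->
      (INR #|F| <= c * INR n * INR (logstar n))%R.
Proof.
case=> // w w_gt0.
pose A := 2 * w * (1 + 3 * (2 * w)) * (w * w).
pose B := w * w * (w + w.+1 * w.+1 * (2 * w * w)).
(* With [N = logstar n + 1] the bound reads [2 * (1 + (A + N * B) * n)]; as [logstar n >= 1], [N] is
   at most [2 * logstar n], and 1 and [A * n] are absorbed too. *)
exists (INR (2 * (1 + A + 2 * B))); split.
  by apply: lt_0_INR; apply/ltP; rewrite muln_gt0.
move=> n F n_gt0 cfF; rewrite -!mult_INR; apply: le_INR; apply/leP.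
apply: leq_trans (card_cross_free n_gt0 w_gt0 cfF (ltn_tower_logstar n)) _.
have := logstar_gt0 n; rewrite -/A -/B; move: (logstar n) A B => l A B l_gt0.
rewrite !multE -2!mulnA leq_mul2l /=.
have le1 : 1 <= n * l by rewrite muln_gt0 n_gt0.
have le2 : A * n <= A * (n * l) by rewrite leq_mul2l leq_pmulr ?orbT.
have le3 : l.+1 * B * n <= 2 * B * (n * l).
  rewrite -mulnA (mulnC 2 B) -mulnA (mulnCA B) (mulnC l.+1) mulnCA.
  by rewrite -mulnA; nia.
by rewrite mulnDl addnA (mulnDl _ (2 * B)) leq_add // (mulnDl 1) mul1n leq_add.
Qed.
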